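(* Let $\mathcal{C}$ be a convex cone in a real linear space and let $\Phi:\mathcal{C}\rightarrow\mathbb{R}_{+}$ be a strongly superadditive function such that $\mathbf{x}\leq\mathbf{y}$ in $\mathcal{C}$ implies $\Phi(\mathbf{x})\leq\Phi(\mathbf{y})$. Then for every $\mathbf{x},\mathbf{y},\mathbf{z}\in\mathcal{C}$ and every nondecreasing and convex real-valued function $f$ defined on an interval including the range of $\Phi$, we have \[ f\left(\Phi(\mathbf{x}+\mathbf{y}+\mathbf{z})\right)+f\left(\Phi(\mathbf{z})\right)\geq f\left(\Phi(\mathbf{x}+\mathbf{z})\right)+f\left(\Phi(\mathbf{y}+\mathbf{z})\right) \] and \[ \frac{f(\Phi(\mathbf{x}))+f(\Phi(\mathbf{y}))+f(\Phi(\mathbf{z}))}{3}+f\left(\Phi(\mathbf{x}+\mathbf{y}+\mathbf{z})\right)\geq\frac{2}{3}\left(f(\Phi(\mathbf{x}+\mathbf{y}))+f(\Phi(\mathbf{y}+\mathbf{z}))+f(\Phi(\mathbf{x}+\mathbf{z}))\right). \] If instead $f$ is nonincreasing and concave, then the last inequality holds in the other direction (with $\leq$ in place of $\geq$).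
   Context: $\mathbb{R}_{+}=[0,\infty)$. A convex cone $\mathcal{C}$ is a subset of a real linear space such that $a\mathbf{x}+b\mathbf{y}\in\mathcal{C}$ whenever $a,b>0$ and $\mathbf{x},\mathbf{y}\in\mathcal{C}$; the origin need not belong to $\mathcal{C}$. The relation $\mathbf{x}\leq\mathbf{y}$ is the one induced by the cone: $\mathbf{y}-\mathbf{x}\in\mathcal{C}\cup\{0\}$. A function $\Phi:\mathcal{C}\to\mathbb{R}$ is strongly superadditive if $\Phi(\mathbf{x}+\mathbf{y})\geq\Phi(\mathbf{x})+\Phi(\mathbf{y})$ for all $\mathbf{x},\mathbf{y}\in\mathcal{C}$ and $\Phi(\mathbf{x}+\mathbf{y}+\mathbf{z})+\Phi(\mathbf{z})\geq\Phi(\mathbf{x}+\mathbf{z})+\Phi(\mathbf{y}+\mathbf{z})$ for all $\mathbf{x},\mathbf{y},\mathbf{z}\in\mathcal{C}$. *)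

(* Defs.v *)
From HB Require Import structures.
From mathcomp Require Import all_boot all_order all_algebra.
From mathcomp Require Import all_classical all_reals all_analysis.

Set Implicit Arguments.
Unset Strict Implicit.
Unset Printing Implicit Defensive.

Import Order.TTheory GRing.Theory Num.Theory.

Local Open Scope classical_set_scope.
Local Open Scope ring_scope.
Local Open Scope convex_scope.

(* The scalars are strictly positive, so the origin need not belong to C. *)
Definition convex_cone (R : realType) (V : lmodType R) (C : set V) : Prop :=
  forall (a b : R) (x y : V),
    0 < a -> 0 < b -> C x -> C y -> C (a *: x + b *: y).

Definition cone_le (R : realType) (V : lmodType R) (C : set V) (x y : V) : Prop :=
  (C `|` [set 0]) (y - x).

(* A function on C is a total function on V of which only the values on C
   are constrained. *)
Definition strongly_superadditive (R : realType) (V : lmodType R)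
    (C : set V) (Phi : V -> R) : Prop :=
  (forall x y : V, C x -> C y -> Phi x + Phi y <= Phi (x + y)) /\
  (forall x y z : V, C x -> C y -> C z ->
     Phi (x + z) + Phi (y + z) <= Phi (x + y + z) + Phi z).

Definition cone_nondecreasing (R : realType) (V : lmodType R)
    (C : set V) (Phi : V -> R) : Prop :=
  forall x y : V, C x -> C y -> cone_le C x y -> Phi x <= Phi y.

(* Mirror image of convex_function from mathcomp.analysis.convex. *)
Definition concave_function (R : numFieldType) (E : lmodType R)
    (E' := convex_lmodType E) (D : set E') (f : E' -> R^o) : Prop :=
  forall t : {i01 R},
    {in D &, forall x y : E', (f x <| t |> f y <= f (x <| t |> y))%R}.

(* Main.v *)
(* With a <= b, c and b + c <= a + d, the points b and c are mirror-image convex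
   combinations of a and b + c - a <= d, so a nondecreasing convex f satisfies
   f b + f c <= f a + f d.  For a = Phi z, b = Phi (x + z), c = Phi (y + z) and
   d = Phi (x + y + z) this is the first inequality; adding its three instances
   obtained by permuting x, y, z cyclically gives the second one.  The concave
   case is the convex one for - f. *)
Require Import Defs.
From HB Require Import structures.
From mathcomp Require Import all_boot all_order all_algebra.
From mathcomp Require Import all_classical all_reals all_analysis.
From mathcomp Require Import ring lra.

Set Implicit Arguments.
Unset Strict Implicit.
Unset Printing Implicit Defensive.

Import Order.TTheory GRing.Theory Num.Theory.

Local Open Scope classical_set_scope.
Local Open Scope ring_scope.

(** Gives convexity with an explicit real weight, a form that [field] and [lra] can work with. *)
Lemma convex_functionE (R : realType) (I : set R) (f : R -> R) (s t k : R) :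
  convex_function (I : set R^o) f -> I s -> I t -> 0 <= k <= 1 ->
  f (k * s + (1 - k) * t) <= k * f s + (1 - k) * f t.
Proof.
move=> cvxf Is It /andP[k0 k1].
exact: (cvxf (Itv01 k0 k1) s t (mem_set Is) (mem_set It)).
Qed.

Lemma convex_functionN (R : realType) (I : set R) (f : R -> R) :
  concave_function (I : set R^o) f ->
  convex_function (I : set R^o) (fun t => - f t).
Proof.
move=> ccvf k s t Is It.
have := ccvf k s t Is It.
by rewrite -lerN2 => /le_trans; apply; rewrite convN.
Qed.

Lemma nondecreasing_convex_le (R : realType) (I : set R) (f : R -> R)
    (a b c d : R) :
  is_interval I -> {in I &, {homo f : s t / s <= t}} ->
  convex_function (I : set R^o) f ->
  I a -> I d -> a <= b -> a <= c -> b + c <= a + d ->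
  f b + f c <= f a + f d.
Proof.
move=> I_itv ndf cvxf Ia Id ab ac bcad.
have Ie : I (b + c - a) by apply: (I_itv a d) => //; apply/andP; split; lra.
have fed : f (b + c - a) <= f d by apply: ndf; rewrite ?inE //; lra.
suff : f b + f c <= f a + f (b + c - a) by lra.
(* The interval from [a] to [b + c - a] may collapse to a point, which would make the denominator of
   the weight [k] zero; then [a], [b] and [c] coincide. *)
have [abc|abc] := leP (b + c - a) a.
  by have [-> ->] : b = a /\ c = a; [split; lra | rewrite addrK].
have e0 : 0 < b - a + (c - a) by lra.
(* The denominator is the length of the interval from [a] to [b + c - a], and [c - a] is the
   distance from [b] to its right end; so [k] is the weight of [a] in [b]. *)
pose k := (c - a) / (b - a + (c - a)).
have k01 : 0 <= k <= 1.
  by rewrite divr_ge0 ?subr_ge0 ?(ltW e0) //= ler_pdivrMr // mul1r; lra.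
(* Swapping the endpoints under the same weight gives [b] once and [c] once; in the sum of the two
   bounds the weights [k] and [1 - k] add up to 1 at each endpoint. *)
have := convex_functionE cvxf Ia Ie k01.
have := convex_functionE cvxf Ie Ia k01.
have -> : k * a + (1 - k) * (b + c - a) = b by rewrite /k; field; lra.
have -> : k * (b + c - a) + (1 - k) * a = c by rewrite /k; field; lra.
lra.
Qed.

Lemma convex_coneD (R : realType) (V : lmodType R) (C : set V) (x y : V) :
  convex_cone C -> C x -> C y -> C (x + y).
Proof.
by move=> C_cone Cx Cy; have := C_cone 1 1 x y ltr01 ltr01 Cx Cy; rewrite !scale1r.
Qed.

Lemma convex_strongly_superadditive (R : realType) (V : lmodType R)
    (C : set V) (Phi : V -> R) (I : set R) (f : R -> R) (x y z : V) :
  convex_cone C -> strongly_superadditive C Phi -> cone_nondecreasing C Phi ->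
  is_interval I -> Phi @` C `<=` I ->
  {in I &, {homo f : s t / s <= t}} -> convex_function (I : set R^o) f ->
  C x -> C y -> C z ->
  f (Phi (x + z)) + f (Phi (y + z)) <= f (Phi (x + y + z)) + f (Phi z).
Proof.
move=> C_cone [_ ssa] Phi_nd I_itv PhiI ndf cvxf Cx Cy Cz.
have CD u v : C u -> C v -> C (u + v) by exact: convex_coneD.
have IPhi u : C u -> I (Phi u) by move=> Cu; apply: PhiI; exists u.
(* The difference [u + z - z] is [u], which is in the cone itself. *)
have Phi_le u : C u -> Phi z <= Phi (u + z).
  by move=> Cu; apply: Phi_nd => //; [exact: CD | by left; rewrite addrK].
rewrite [leRHS]addrC; apply: (nondecreasing_convex_le I_itv) => //.
- exact: IPhi.
- by apply: IPhi; apply: (CD _ _ (CD _ _ Cx Cy) Cz).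
- exact: Phi_le.
- exact: Phi_le.
- by rewrite [leRHS]addrC; exact: ssa.
Qed.

Lemma convex_strongly_superadditive_cyclic (R : realType) (V : lmodType R)
    (C : set V) (Phi : V -> R) (I : set R) (f : R -> R) (x y z : V) :
  convex_cone C -> strongly_superadditive C Phi -> cone_nondecreasing C Phi ->
  is_interval I -> Phi @` C `<=` I ->
  {in I &, {homo f : s t / s <= t}} -> convex_function (I : set R^o) f ->
  C x -> C y -> C z ->
  2 / 3 * (f (Phi (x + y)) + f (Phi (y + z)) + f (Phi (x + z))) <=
    (f (Phi x) + f (Phi y) + f (Phi z)) / 3 + f (Phi (x + y + z)).
Proof.
move=> C_cone ssa Phi_nd I_itv PhiI ndf cvxf Cx Cy Cz.
have key := convex_strongly_superadditive C_cone ssa Phi_nd I_itv PhiI ndf cvxf.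
have xyz := key _ _ _ Cx Cy Cz.
have := key _ _ _ Cy Cz Cx; rewrite (addrC y x) (addrC z x) (addrC _ x) addrA => yzx.
have := key _ _ _ Cz Cx Cy; rewrite (addrC z y) (addrC z x) (addrAC x z y) => zxy.
(* In the sum of the three instances each pair term occurs twice, each single term once and the full
   sum three times; dividing by 3 gives the coefficients. *)
lra.
Qed.

Theorem theorem8 (R : realType) (V : lmodType R) (C : set V) (Phi : V -> R)
    (C_cone : convex_cone C)
    (Phi_ge0 : forall x : V, C x -> 0 <= Phi x)
    (Phi_ssa : strongly_superadditive C Phi)
    (Phi_nd : cone_nondecreasing C Phi)
    (x y z : V) (Cx : C x) (Cy : C y) (Cz : C z)
    (I : set R) (f : R -> R)
    (I_itv : is_interval I) (PhiI : Phi @` C `<=` I) :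
  ({in I &, {homo f : s t / s <= t}} ->
   convex_function (I : set R^o) f ->
     f (Phi (x + z)) + f (Phi (y + z)) <= f (Phi (x + y + z)) + f (Phi z) /\
     2 / 3 * (f (Phi (x + y)) + f (Phi (y + z)) + f (Phi (x + z))) <=
       (f (Phi x) + f (Phi y) + f (Phi z)) / 3 + f (Phi (x + y + z))) /\
  ({in I &, {homo f : s t / s <= t >-> t <= s}} ->
   concave_function (I : set R^o) f ->
     (f (Phi x) + f (Phi y) + f (Phi z)) / 3 + f (Phi (x + y + z)) <=
       2 / 3 * (f (Phi (x + y)) + f (Phi (y + z)) + f (Phi (x + z)))).
Proof.
split=> [ndf cvxf | nif ccvf].
  split.
    exact: (convex_strongly_superadditive C_cone Phi_ssa Phi_nd I_itv PhiI).
  exact: (convex_strongly_superadditive_cyclic C_cone Phi_ssa Phi_nd I_itv PhiI).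
have ndNf : {in I &, {homo (fun t => - f t) : s t / s <= t}}.
  by move=> s t Is It st; rewrite lerN2; exact: nif.
have := convex_strongly_superadditive_cyclic C_cone Phi_ssa Phi_nd I_itv PhiI
  ndNf (convex_functionN ccvf) Cx Cy Cz.
lra.
Qed.
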